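(* Let $\Xi_P=[0,1]^{n_0}\subset\mathbb{R}^{n_0}$ be the hypercube and let $\omega^{(1)},\dots,\omega^{(n_0+1)}\in\mathbb{R}^{n_0}$ be affinely independent points with convex hull the simplex $S$. Let $\sigma^*$ be the smallest scaling factor $\sigma$ such that some translate of $\sigma S$ contains $\Xi_P$, and let $t^*$ be the corresponding translation vector, so that $\Xi_P\subseteq\sigma^*S+t^*$. Then $$t^*=\sum_{i=1}^{n_0+1}\sum_{j=1}^{n_0}\min\{0,l_{ij}\}\,\omega^{(i)}\qquad\text{and}\qquad\sigma^*=\frac12\sum_{i=1}^{n_0+1}\sum_{j=1}^{n_0}|l_{ij}|.$$
   Context: $D$ is the invertible $(n_0+1)\times(n_0+1)$ matrix whose $i$-th column is $\omega^{(i)}$ followed by a final entry equal to $1$, and $l_{ij}$ ($1\le i,j\le n_0+1$) denote the entries of $D^{-1}$. For $\sigma>0$ and $t\in\mathbb{R}^{n_0}$, $\sigma S+t=\{\sigma s+t:s\in S\}$. *)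

(* Defs.v *)
From mathcomp Require Export all_boot all_order all_algebra.
From mathcomp Require Export all_classical all_reals.

Set Implicit Arguments.
Unset Strict Implicit.
Unset Printing Implicit Defensive.

Import Order.TTheory GRing.Theory Num.Theory.

Local Open Scope classical_set_scope.
Local Open Scope ring_scope.

Definition hypercube (R : realType) (n : nat) : set 'cV[R]_n :=
  [set x | forall j : 'I_n, 0 <= x j ord0 <= 1].
Arguments hypercube : clear implicits.

Definition affinely_independent (R : realType) (n m : nat)
    (omega : 'I_m -> 'cV[R]_n) : Prop :=
  forall c : 'I_m -> R,
    \sum_(i < m) c i = 0 -> \sum_(i < m) c i *: omega i = 0 ->
    forall i, c i = 0.

Definition convex_hull (R : realType) (n m : nat)
    (omega : 'I_m -> 'cV[R]_n) : set 'cV[R]_n :=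
  [set x | exists mu : 'I_m -> R,
    [/\ forall i, 0 <= mu i, \sum_(i < m) mu i = 1
      & x = \sum_(i < m) mu i *: omega i]].

Definition scale_translate (R : realType) (n : nat) (sigma : R) (t : 'cV[R]_n)
    (S : set 'cV[R]_n) : set 'cV[R]_n :=
  [set sigma *: s + t | s in S].

Definition covering_scalings (R : realType) (n : nat)
    (S Xi : set 'cV[R]_n) : set R :=
  [set sigma | 0 < sigma /\
    exists t : 'cV[R]_n, Xi `<=` scale_translate sigma t S].

Definition is_smallest_covering (R : realType) (n : nat)
    (S Xi : set 'cV[R]_n) (sigma : R) (t : 'cV[R]_n) : Prop :=
  [/\ covering_scalings S Xi sigma,
      lbound (covering_scalings S Xi) sigma
    & Xi `<=` scale_translate sigma t S].

Definition vertex_mx (R : realType) (n : nat)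
    (omega : 'I_(n + 1) -> 'cV[R]_n) : 'M[R]_(n + 1) :=
  col_mx (\matrix_(j < n, i < n + 1) omega i j ord0) (const_mx 1 : 'rV[R]_(n + 1)).

(* Outside [unitmx], [invmx] is the identity; by this lemma
   [invmx (vertex_mx omega)] is a genuine inverse. *)
Lemma vertex_mx_unit (R : realType) (n : nat)
    (omega : 'I_(n + 1) -> 'cV[R]_n) :
  affinely_independent omega -> vertex_mx omega \in unitmx.
Proof.
move=> aff; rewrite -unitmx_tr -row_free_unit -kermx_eq0.
apply/eqP/row_matrixP => k; rewrite row0; set u := row k _.
have : u *m (vertex_mx omega)^T = row_mx 0 0.
  by rewrite row_mx0; apply/sub_kermxP; exact: row_sub.
rewrite /vertex_mx tr_col_mx mul_mx_row => /eq_row_mx [u1 u2].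
suff u0 i : u ord0 i = 0 by apply/rowP => i; rewrite u0 [RHS]mxE.
have uS : \sum_(k < n + 1) u ord0 k = 0.
  have /rowP/(_ ord0) := u2; rewrite !mxE => e; rewrite -[RHS]e.
  by apply: eq_bigr => j _; rewrite !mxE mulr1.
apply: (aff (u ord0) uS).
apply/colP => j; have /rowP/(_ j) := u1.
rewrite summxE !mxE => e; rewrite -[RHS]e.
by apply: eq_bigr => h _; rewrite !mxE.
Qed.

(* Main.v *)
(* The homogeneous barycentric coordinates of [(y, sigma)] are the entries of
   [D^-1 (y, sigma)], and [x] lies in [sigma S + t] iff those of
   [(x - t, sigma)] are nonnegative.  Let [v_i = \sum_j min (0, l_ij)] be the
   minimum over the cube of the linear form [x |-> \sum_j l_ij x_j].  The cube
   is covered iff the coordinates [c_i] of [(- t, sigma)] satisfy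
   [c_i >= - v_i].  As they add up to [sigma], the least [sigma] is
   [- \sum_i v_i], attained exactly when [c_i = - v_i] for all [i], which
   determines [t].  Finally [\sum_i l_ij = 0] for [j <= n0] turns
   [- 2 \sum_i v_i] into the sum of the [|l_ij|]. *)
Require Import Defs.
From mathcomp Require Import lra.

Set Implicit Arguments.
Unset Strict Implicit.
Unset Printing Implicit Defensive.

Import Order.TTheory GRing.Theory Num.Theory.

Local Open Scope classical_set_scope.
Local Open Scope ring_scope.

Definition bary (R : realType) (n : nat) (omega : 'I_(n + 1) -> 'cV[R]_n)
    (y : 'cV[R]_n) (s : R) : 'cV[R]_(n + 1) :=
  invmx (vertex_mx omega) *m col_mx y s%:M.

Definition cube_min (R : realType) (n : nat) (omega : 'I_(n + 1) -> 'cV[R]_n)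
    (i : 'I_(n + 1)) : R :=
  \sum_(j < n) Num.min 0 (invmx (vertex_mx omega) i (lshift 1 j)).

Lemma mul_vertex_mx (R : realType) (n : nat)
    (omega : 'I_(n + 1) -> 'cV[R]_n) (c : 'cV[R]_(n + 1)) :
  vertex_mx omega *m c =
  col_mx (\sum_i c i ord0 *: omega i) (\sum_i c i ord0)%:M.
Proof.
rewrite mul_col_mx; congr col_mx; apply/matrixP => j k; rewrite (ord1 k).
  by rewrite summxE !mxE; apply: eq_bigr => i _; rewrite !mxE mulrC.
rewrite (ord1 j) !mxE eqxx mulr1n.
by apply: eq_bigr => i _; rewrite !mxE mul1r.
Qed.

Lemma baryE (R : realType) (n : nat) (omega : 'I_(n + 1) -> 'cV[R]_n)
    (y : 'cV[R]_n) (s : R) (i : 'I_(n + 1)) :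
  bary omega y s i ord0 =
  \sum_(j < n) invmx (vertex_mx omega) i (lshift 1 j) * y j ord0 +
  invmx (vertex_mx omega) i (rshift n ord0) * s.
Proof.
rewrite mxE big_split_ord /= big_ord1 col_mxEd mxE eqxx mulr1n; congr (_ + _).
by apply: eq_bigr => j _; rewrite col_mxEu.
Qed.

Lemma baryD (R : realType) (n : nat) (omega : 'I_(n + 1) -> 'cV[R]_n)
    (x y : 'cV[R]_n) (s : R) (i : 'I_(n + 1)) :
  bary omega (x + y) s i ord0 =
  \sum_(j < n) invmx (vertex_mx omega) i (lshift 1 j) * x j ord0 +
  bary omega y s i ord0.
Proof.
rewrite !baryE addrA -big_split /=; congr (_ + _).
by apply: eq_bigr => j _; rewrite mxE mulrDr.
Qed.

Section AffinelyIndependent.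
Variables (R : realType) (n : nat) (omega : 'I_(n + 1) -> 'cV[R]_n).
Hypothesis haff : affinely_independent omega.
Let l : 'M[R]_(n + 1) := invmx (vertex_mx omega).

Lemma bary_comb (y : 'cV[R]_n) (s : R) :
  \sum_i bary omega y s i ord0 *: omega i = y /\
  \sum_i bary omega y s i ord0 = s.
Proof.
have := mul_vertex_mx omega (bary omega y s).
rewrite mulKVmx ?vertex_mx_unit // => /eq_col_mx [<- sE]; split=> //.
(* The trace reads the scalar off a 1 by 1 matrix. *)
by have := congr1 mxtrace sE; rewrite !mxtrace_scalar.
Qed.

(** Multiplication by [vertex_mx omega] is injective, so the weights are determined; they may have
    any sign and any sum. *)
Lemma bary_uniq (c : 'I_(n + 1) -> R) (i : 'I_(n + 1)) :
  bary omega (\sum_k c k *: omega k) (\sum_k c k) i ord0 = c i.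
Proof.
have colE k : (\col_h c h) k ord0 = c k by rewrite mxE.
under eq_bigr do rewrite -colE; under [X in bary _ _ X]eq_bigr do rewrite -colE.
by rewrite /bary -mul_vertex_mx mulKmx ?vertex_mx_unit.
Qed.

(** Dividing nonnegative coordinates of [(x - t, sigma)] by [sigma] yields convex weights for
    [sigma^-1 *: (x - t)]. *)
Lemma scale_translate_bary (sigma : R) (t x : 'cV[R]_n) : 0 < sigma ->
  scale_translate sigma t (convex_hull omega) x <->
  forall i, 0 <= bary omega (x - t) sigma i ord0.
Proof.
move=> s0; split=> [[s [mu [mu0 mu1 ->]] <-] i|b0].
  rewrite addrK scaler_sumr; under eq_bigr do rewrite scalerA.
  (* Writing [sigma] as the sum of the [sigma * mu k] gives both arguments of [bary] the same
     weights. *)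
  rewrite -[X in bary _ _ X]mulr1 -mu1 mulr_sumr bary_uniq.
  by rewrite mulr_ge0 // ltW.
have [bx bs] := bary_comb (x - t) sigma.
exists (sigma^-1 *: (x - t)); last first.
  by rewrite scalerA mulfV ?gt_eqF // scale1r subrK.
exists (fun i => sigma^-1 * bary omega (x - t) sigma i ord0); split.
- by move=> i; rewrite mulr_ge0 // invr_ge0 ltW.
- by rewrite -mulr_sumr bs mulVf ?gt_eqF.
- by rewrite -[in LHS]bx scaler_sumr; apply: eq_bigr => i _; rewrite scalerA.
Qed.

Lemma cube_covered (sigma : R) (t : 'cV[R]_n) : 0 < sigma ->
  hypercube R n `<=` scale_translate sigma t (convex_hull omega) <->
  forall i, - cube_min omega i <= bary omega (- t) sigma i ord0.
Proof.
move=> s0; split=> [cov i|cmin x x01].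
  (* The vertex of the cube at which the [i]-th linear form attains its minimum. *)
  pose x : 'cV[R]_n := \col_j (l i (lshift 1 j) < 0)%R%:R.
  have /cov/(scale_translate_bary _ _ s0)/(_ i) : hypercube R n x.
    by move=> j; rewrite mxE; case: (_ < 0); rewrite /= ?lexx ler01.
  rewrite baryD.
  suff -> : \sum_(j < n) l i (lshift 1 j) * x j ord0 = cube_min omega i by lra.
  apply: eq_bigr => j _; rewrite mxE -/l.
  by case: ltrP => h; rewrite ?mulr1 ?mulr0.
apply/(scale_translate_bary _ _ s0) => i; rewrite baryD.
have := cmin i.
suff : cube_min omega i <= \sum_(j < n) l i (lshift 1 j) * x j ord0 by lra.
apply: ler_sum => j _; rewrite -/l.
have /andP [x0 x1] := x01 j.
(* For a coefficient [a <= 0] the claim [a <= a * x_j] amounts to [0 <= a * (x_j - 1)]. *)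
by case: (ltrP 0 (l i (lshift 1 j))) => h; nra.
Qed.

(** The last row of [vertex_mx omega] is constantly 1, so this sum is an off-diagonal entry of
    [D D^-1]. *)
Lemma sum_invmx_col (j : 'I_n) : \sum_i l i (lshift 1 j) = 0.
Proof.
have /matrixP/(_ (rshift n ord0) (lshift 1 j)) :=
  mulmxV (vertex_mx_unit haff).
rewrite !mxE eq_rlshift => e; rewrite -[RHS]e.
by apply: eq_bigr => i _; rewrite col_mxEd mxE mul1r.
Qed.

(** Termwise [|a| = a - 2 min(0, a)], and the sum of the [a] vanishes column by column. *)
Lemma sum_cube_min :
  - \sum_i cube_min omega i = 1 / 2 * \sum_i \sum_(j < n) `|l i (lshift 1 j)|.
Proof.
have -> : \sum_i \sum_(j < n) `|l i (lshift 1 j)| =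
          \sum_i \sum_(j < n) l i (lshift 1 j) - 2 * \sum_i cube_min omega i.
  rewrite mulr_sumr -sumrB; apply: eq_bigr => i _.
  rewrite mulr_sumr -sumrB; apply: eq_bigr => j _; rewrite -/l.
  by case: (ltrP 0 (l i (lshift 1 j))) => h;
    rewrite ?(gtr0_norm h) ?(ler0_norm h); lra.
rewrite [X in X - _]exchange_big [X in X - _]big1 => [|j _]; first by lra.
exact: sum_invmx_col.
Qed.

(** Otherwise every [l i (lshift 1 j)] would be 0, and [D D^-1] would have a zero on its
    diagonal. *)
Lemma sum_cube_min_gt0 : (0 < n)%N -> 0 < - \sum_i cube_min omega i.
Proof.
move=> n0; rewrite sum_cube_min mulr_gt0 ?divr_gt0 //.
have sum_ge0 i : 0 <= \sum_(j < n) `|l i (lshift 1 j)| by exact: sumr_ge0.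
rewrite lt_def sumr_ge0 // andbT; apply/eqP => s0.
pose j := Ordinal n0.
have l0 i : l i (lshift 1 j) = 0.
  have row0 := psumr_eq0P (fun k _ => sum_ge0 k) s0 (i := i) isT.
  by apply/normr0_eq0; exact: (psumr_eq0P (fun k _ => normr_ge0 _) row0).
have /matrixP/(_ (lshift 1 j) (lshift 1 j)) := mulmxV (vertex_mx_unit haff).
rewrite !mxE eqxx big1 => [/eqP|i _]; last by rewrite -/l l0 mulr0.
by rewrite eq_sym oner_eq0.
Qed.

Lemma covering_ge (sigma : R) (t : 'cV[R]_n) : 0 < sigma ->
  hypercube R n `<=` scale_translate sigma t (convex_hull omega) ->
  - \sum_i cube_min omega i <= sigma.
Proof.
move=> s0 /(cube_covered _ s0) cmin.
by rewrite -(bary_comb (- t) sigma).2 -sumrN ler_sum.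
Qed.

Lemma covering_min : (0 < n)%N ->
  is_smallest_covering (convex_hull omega) (hypercube R n)
    (- \sum_i cube_min omega i) (\sum_i cube_min omega i *: omega i).
Proof.
move=> n0; have s0 := sum_cube_min_gt0 n0.
have cov : hypercube R n `<=` scale_translate (- \sum_i cube_min omega i)
    (\sum_i cube_min omega i *: omega i) (convex_hull omega).
  apply/(cube_covered _ s0) => i.
  (* With the signs moved inside the sums, [bary_uniq] turns each inequality into an equality. *)
  rewrite -[X in bary _ _ X]sumrN -[X in bary _ X]sumrN.
  by under [X in bary _ X]eq_bigr do rewrite -scaleNr; rewrite bary_uniq.
split=> //; first by split=> //; eexists; exact: cov.
by move=> s [s1 [t /(covering_ge s1)]].
Qed.

Lemma covering_min_uniq (t : 'cV[R]_n) : 0 < - \sum_i cube_min omega i ->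
  hypercube R n `<=`
    scale_translate (- \sum_i cube_min omega i) t (convex_hull omega) ->
  t = \sum_i cube_min omega i *: omega i.
Proof.
set sigma := - _ => s0 /(cube_covered _ s0) cmin.
have [bt bs] := bary_comb (- t) sigma.
(* Nonnegative slacks with sum zero all vanish; this fixes the coordinates of [(- t, sigma)], hence
   [t]. *)
have slack_ge0 i : 0 <= bary omega (- t) sigma i ord0 + cube_min omega i.
  by rewrite -[cube_min _ _]opprK subr_ge0.
have slack_sum :
    \sum_i (bary omega (- t) sigma i ord0 + cube_min omega i) = 0.
  by rewrite big_split /= bs addNr.
have slack0 i := psumr_eq0P (fun k _ => slack_ge0 k) slack_sum (i := i) isT.
apply: oppr_inj; rewrite -[LHS]bt -sumrN; apply: eq_bigr => i _.
by rewrite -scaleNr; congr (_ *: _); apply/eqP; rewrite -addr_eq0 slack0.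
Qed.

End AffinelyIndependent.

Theorem corollary4 (R : realType) (n0 : nat)
    (omega : 'I_(n0 + 1) -> 'cV[R]_n0) (haff : affinely_independent omega) :
  let S := convex_hull omega in
  let Xi := hypercube R n0 in
  let l := invmx (vertex_mx omega) in
  ((0 < n0)%N ->
     exists (sigma : R) (t : 'cV[R]_n0), is_smallest_covering S Xi sigma t) /\
  (forall (sigma : R) (t : 'cV[R]_n0),
     is_smallest_covering S Xi sigma t ->
     t = \sum_(i < n0 + 1) \sum_(j < n0)
           Num.min 0 (l i (lshift 1 j)) *: omega i /\
     sigma = 1 / 2 * \sum_(i < n0 + 1) \sum_(j < n0) `|l i (lshift 1 j)|).
Proof.
move=> S Xi l; split=> [n_gt0|sigma t [[s0 _] smin cov]].
  by do 2 eexists; exact: covering_min.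
(* In dimension 0 every positive factor covers, so none is smallest: [sigma / 2] beats [sigma]. *)
have n_gt0 : (0 < n0)%N.
  rewrite lt0n; apply/eqP => n_eq0.
  suff /smin : covering_scalings S Xi (sigma / 2) by lra.
  have no_coord (j : 'I_n0) : False by case: j => j; rewrite n_eq0.
  (* Covering the origin supplies a point of [S]. *)
  have [|p Sp _] := cov 0; first by move=> j; case: (no_coord j).
  split; first by rewrite divr_gt0.
  exists 0 => x _; exists p => //.
  by apply/colP => j; case: (no_coord j).
have sE : sigma = - (\sum_i cube_min omega i).
  apply/le_anti/andP; split; last exact: (covering_ge haff s0 cov).
  by have [/smin] := covering_min haff n_gt0.
rewrite -sum_cube_min // -sE; split=> //.
rewrite sE in s0 cov; rewrite (covering_min_uniq haff s0 cov).
by apply: eq_bigr => i _; rewrite scaler_suml.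
Qed.
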